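(* Let $H_n$ be the height of a tree taken uniformly at random from $\mathcal Y_n$. There exists a continuous increasing function $I(u)$, defined and satisfying $I(u)>0$ for $0<u\le1$, such that, given any fixed $\delta>0$, one has, for all $x\in[\delta,1-\delta]$ and all $n$, $$\mathbb P(H_n\ge xn)\le K\,n^{3/2}e^{-nI(x)},$$ where the constant $K$ depends only on $\delta$.
   Context: The class $\mathcal Y$ of non-plane, unlabelled, rooted binary trees (considered up to isomorphism) is defined recursively: a tree of $\mathcal Y$ is either a single external node, or a root (an internal node) attached to an unordered pair (multiset of two elements) of trees of $\mathcal Y$. The size of a tree is its number of external nodes; $\mathcal Y_n$ is the set of trees of size $n$ ($n\ge1$). The height of a tree is the maximum number of edges along a branch connecting the root to an external node. *)

(* Defs.v *)
From HB Require Import structures.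
From mathcomp Require Import all_boot all_order all_algebra finmap.
From mathcomp Require Import all_classical all_reals all_analysis.
Import Order.TTheory GRing.Theory Num.Theory.
Import numFieldNormedType.Exports.

Set Implicit Arguments.
Unset Strict Implicit.
Unset Printing Implicit Defensive.

Local Open Scope classical_set_scope.
Local Open Scope ring_scope.

(* Plane trees: only representatives. The trees of the class Y are their
   isomorphism classes (the type [ytree] below). *)
Inductive ptree : Type := Leaf | Node of ptree & ptree.

Fixpoint ptree_code (t : ptree) : GenTree.tree unit :=
  match t with
  | Leaf => GenTree.Leaf tt
  | Node l r => GenTree.Node 0 [:: ptree_code l; ptree_code r]
  end.

Fixpoint ptree_decode (c : GenTree.tree unit) : option ptree :=
  match c with
  | GenTree.Leaf _ => Some Leaf
  | GenTree.Node _ [:: a; b] =>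
      match ptree_decode a, ptree_decode b with
      | Some l, Some r => Some (Node l r)
      | _, _ => None
      end
  | _ => None
  end.

Lemma ptree_codeK : pcancel ptree_code ptree_decode.
Proof. by elim=> [|l IHl r IHr] //=; rewrite IHl IHr. Qed.

HB.instance Definition _ := Countable.copy ptree (pcan_type ptree_codeK).

Fixpoint psize (t : ptree) : nat :=
  if t is Node l r then (psize l + psize r)%N else 1%N.

Fixpoint pheight (t : ptree) : nat :=
  if t is Node l r then (maxn (pheight l) (pheight r)).+1 else 0%N.

(* Isomorphism of rooted binary trees, the two subtrees of a node being
   unordered. *)
Fixpoint piso (t u : ptree) : bool :=
  match t, u with
  | Leaf, Leaf => true
  | Node a b, Node c d => (piso a c && piso b d) || (piso a d && piso b c)
  | _, _ => false
  end.

Lemma piso_refl : reflexive piso.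
Proof. by elim=> [|l IHl r IHr] //=; rewrite IHl IHr. Qed.

Lemma piso_sym : symmetric piso.
Proof.
elim=> [|a IHa b IHb] [|c d] //=; rewrite !IHa !IHb.
by rewrite [piso d a && _]andbC.
Qed.

Lemma piso_trans : transitive piso.
Proof.
move=> u t v; elim: t u v => [|a IHa b IHb] [|c d] [|e f] //=.
case/orP=> /andP[h1 h2] /orP[] /andP[h3 h4].
- by rewrite (IHa _ _ h1 h3) (IHb _ _ h2 h4).
- by rewrite (IHa _ _ h1 h3) (IHb _ _ h2 h4) orbT.
- by rewrite (IHa _ _ h1 h4) (IHb _ _ h2 h3) orbT.
- by rewrite (IHa _ _ h1 h4) (IHb _ _ h2 h3).
Qed.

Canonical piso_equiv := EquivRel piso piso_refl piso_sym piso_trans.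

Definition ytree : Type := {eq_quot piso_equiv}%qT.
HB.instance Definition _ := Choice.on ytree.

(* Size (number of external nodes) and height of a class, read off a
   representative; [ysize_pi] and [yheight_pi] show independence of it. *)
Definition ysize (t : ytree) : nat := psize (repr t).
Definition yheight (t : ytree) : nat := pheight (repr t).

Definition ypi (p : ptree) : ytree := (\pi_ytree p)%qT.

Definition yleaf : ytree := ypi Leaf.
Definition ynode (a b : ytree) : ytree := ypi (Node (repr a) (repr b)).

Lemma ypi_eq (p q : ptree) : ypi p = ypi q <-> piso p q.
Proof. by split=> [/eqmodP|h] //; apply/eqmodP. Qed.

Lemma ypiK (t : ytree) : ypi (repr t) = t.
Proof. exact: reprK. Qed.

Lemma piso_repr (p : ptree) : piso (repr (ypi p)) p.
Proof. by apply/ypi_eq; rewrite ypiK. Qed.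

Lemma piso_size (t u : ptree) : piso t u -> psize t = psize u.
Proof.
elim: t u => [|a IHa b IHb] [|c d] //=.
by case/orP=> /andP[/IHa-> /IHb->] //; rewrite addnC.
Qed.

Lemma piso_height (t u : ptree) : piso t u -> pheight t = pheight u.
Proof.
elim: t u => [|a IHa b IHb] [|c d] //=.
by case/orP=> /andP[/IHa-> /IHb->] //; rewrite maxnC.
Qed.

Lemma ysize_pi (p : ptree) : ysize (ypi p) = psize p.
Proof. exact/piso_size/piso_repr. Qed.

Lemma yheight_pi (p : ptree) : yheight (ypi p) = pheight p.
Proof. exact/piso_height/piso_repr. Qed.

(* [ytree] satisfies the recursive specification of the class: a tree is
   either a leaf or a node carrying a multiset of two trees. *)
Lemma ytree_cases (t : ytree) : t = yleaf \/ exists a b, t = ynode a b.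
Proof.
rewrite -(ypiK t); case: (repr t) => [|l r]; [by left | right].
exists (ypi l), (ypi r); apply/ypi_eq => /=.
by rewrite !(piso_sym _ (repr _)) !piso_repr.
Qed.

Lemma yleaf_neq_ynode (a b : ytree) : yleaf <> ynode a b.
Proof. by move/ypi_eq. Qed.

Lemma ynode_eq (a b c d : ytree) :
  ynode a b = ynode c d <-> (a = c /\ b = d) \/ (a = d /\ b = c).
Proof.
have E (x y : ytree) : piso (repr x) (repr y) -> x = y.
  by move/ypi_eq; rewrite !ypiK.
split=> [/ypi_eq/= /orP[]/andP[/E-> /E->]|]; [by left|by right|].
by case=> -[-> ->]; apply/ypi_eq; rewrite /= !piso_refl ?orbT.
Qed.

Lemma ysize_leaf : ysize yleaf = 1%N.
Proof. exact: ysize_pi. Qed.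

Lemma ysize_node (a b : ytree) : ysize (ynode a b) = (ysize a + ysize b)%N.
Proof. exact: ysize_pi. Qed.

Lemma yheight_leaf : yheight yleaf = 0%N.
Proof. exact: yheight_pi. Qed.

Lemma yheight_node (a b : ytree) :
  yheight (ynode a b) = (maxn (yheight a) (yheight b)).+1.
Proof. exact: yheight_pi. Qed.

Definition Y_ (n : nat) : set ytree := [set t | ysize t = n].

(* Representatives of all trees of height at most [k]. *)
Fixpoint ptrees (k : nat) : seq ptree :=
  if k is k'.+1 then Leaf :: [seq Node l r | l <- ptrees k', r <- ptrees k']
  else [:: Leaf].

Lemma mem_ptrees (k : nat) (t : ptree) : (pheight t <= k)%N -> t \in ptrees k.
Proof.
elim: k t => [|k IHk] [|l r] //=; rewrite ltnS geq_max => /andP[hl hr].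
by rewrite inE /=; apply/allpairsP; exists (l, r); split=> //; apply: IHk.
Qed.

Lemma psize_gt0 (t : ptree) : (0 < psize t)%N.
Proof. by elim: t => //= l IHl r IHr; rewrite addn_gt0 IHl. Qed.

Lemma pheight_lt_size (t : ptree) : (pheight t < psize t)%N.
Proof.
elim: t => //= l IHl r IHr.
have hl := psize_gt0 l; have hr := psize_gt0 r.
rewrite -maxnSS gtn_max; apply/andP; split.
  by rewrite -[_.+2]addn1 leq_add.
by rewrite -[_.+2]add1n leq_add.
Qed.

Lemma finite_Y (n : nat) : finite_set (Y_ n).
Proof.
apply: (@sub_finite_set _ _ [set` [seq ypi p | p <- ptrees n]]).
  move=> t /= <-; apply/mapP; exists (repr t); rewrite ?ypiK//.
  exact/mem_ptrees/ltnW/pheight_lt_size.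
exact: finite_seq.
Qed.

Lemma Y_neq0 (n : nat) : (0 < n)%N -> Y_ n !=set0.
Proof.
case: n => // n _; elim: n => [|n [t tn]]; first by exists yleaf; exact: ysize_leaf.
by exists (ynode yleaf t); rewrite /Y_ /= ysize_node ysize_leaf tn.
Qed.

(* Probability of the event [E] for the uniform distribution on a finite
   nonempty set [A]. *)
Definition finite_unif_prob (R : realType) (T : choiceType) (A E : set T) : R :=
  #|` fset_set (A `&` E)|%:R / #|` fset_set A|%:R.

(* Main.v *)
Require Import Defs.
From mathcomp Require Import all_boot all_order all_algebra finmap.
From mathcomp Require Import all_classical all_reals all_analysis.
From mathcomp Require Import ring lra zify.
Import Order.TTheory GRing.Theory Num.Theory.
Import numFieldNormedType.Exports.

Set Implicit Arguments.
Unset Strict Implicit.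
Unset Printing Implicit Defensive.

Local Open Scope classical_set_scope.
Local Open Scope ring_scope.

(* Write a_n for the number of trees of size n, y_N(z) for the sum of z^|t| over
   the trees of size at most N, y for the limit and rho for its radius of
   convergence. The recursive equation 2 y(z) = 2 z + y(z)^2 + y(z^2) reads
   (1 - y(z))^2 = 1 - 2 z - y(z^2). The right-hand side is nonnegative on [0, rho[
   and decreases at least at unit speed, hence y(z) <= 1 - sqrt (rho - z) there:
   this is half of the square-root singularity.
   A tree of height >= h is a branch of length h with a tree hanging off each of
   its nodes, so the trees of size n and height >= h number at most
   z^-n y(z)^(h+1). For h = x n, taking z = rho - s^2 with s proportional to x, this
   is at most rho^-n exp (- n rho x^2 / 8). Finally a_(n+m) >= a_n a_m / 2, so by
   Fekete's argument a_n >= c rho^-n exp (- e n) for every e > 0; spending half of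
   the exponent on this loss leaves I(u) = rho u^2 / 16. *)

(** * Sums over lists of trees and over unordered pairs *)

(** Turns inclusions between families of trees into inequalities of generating functions; [s2] may
    repeat elements, so overcounting is allowed there. *)
Lemma ler_sum_sub (R : numDomainType) (T : eqType) (s1 s2 : seq T) (F : T -> R) :
  (forall x, 0 <= F x) -> uniq s1 -> {subset s1 <= s2} ->
  \sum_(x <- s1) F x <= \sum_(x <- s2) F x.
Proof.
move=> F0; elim: s1 s2 => [|x s1 IH] s2 /=.
  by rewrite big_nil => _ _; apply: sumr_ge0.
case/andP=> xs1 us1 s12.
have p2 := perm_to_rem (s12 x (mem_head _ _)).
rewrite (perm_big _ p2) !big_cons lerD2l; apply: IH => // y ys1.
have := s12 y; rewrite inE ys1 orbT (perm_mem p2) inE => /(_ isT).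
by case: eqP => // yx; rewrite -yx ys1 in xs1.
Qed.

(* An arbitrary total order, used to pick one of the two orderings of an
   unordered pair. *)
Definition yle (a b : ytree) : bool := (choice.pickle (repr a) <= choice.pickle (repr b))%N.

Lemma yle_total : total yle.
Proof. by move=> a b; apply: leq_total. Qed.

Lemma yle_anti : antisymmetric yle.
Proof.
move=> a b; rewrite /yle -eqn_leq => /eqP /(pcan_inj (@choice.pickleK _)) ab.
by rewrite -(ypiK a) -(ypiK b) ab.
Qed.

Lemma ynodeC (a b : ytree) : ynode a b = ynode b a.
Proof. by apply/ynode_eq; right. Qed.

Lemma ynode_yle_inj (u v : ytree * ytree) :
  yle u.1 u.2 -> yle v.1 v.2 -> ynode u.1 u.2 = ynode v.1 v.2 -> u = v.
Proof.
case: u v => a b [c d] /= ab cd /ynode_eq[[-> ->]//|[ad bc]].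
rewrite ad bc in ab *; by rewrite (@yle_anti c d) // cd ab.
Qed.

(** The double sum meets each off-diagonal unordered pair twice and each diagonal pair once; the
    last sum supplies the missing diagonal. *)
Lemma sum_yle (R : pzRingType) (s : seq ytree) (g : ytree -> ytree -> R) :
  uniq s -> (forall a b, g a b = g b a) ->
  (\sum_(u <- [seq (a, b) | a <- s, b <- s] | yle u.1 u.2) g u.1 u.2) *+ 2 =
  \sum_(a <- s) \sum_(b <- s) g a b + \sum_(a <- s) g a a.
Proof.
move=> us gC; rewrite big_mkcond big_allpairs /= mulr2n.
rewrite {2}exchange_big /= -!big_split /=; apply: eq_big_seq => a sa.
have -> : g a a = \sum_(b <- s) (if b == a then g a b else 0).
  by rewrite -big_mkcond -big_filter filter_pred1_uniq // big_seq1.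
rewrite -!big_split /=; apply: eq_bigr => b _; rewrite (gC b a).
have [->|ba] := eqVneq b a; first by rewrite /yle leqnn.
have [ab|ab] := boolP (yle a b); have [ba'|ba'] := boolP (yle b a).
- by rewrite (@yle_anti a b) ?ab // eqxx in ba.
- by rewrite !addr0.
- by rewrite addr0 add0r.
- by have := yle_total a b; rewrite (negPf ab) (negPf ba').
Qed.

(** * Truncated generating functions and their recursive inequalities *)

Definition trees (N : nat) : seq ytree :=
  [seq t <- undup [seq ypi p | p <- ptrees N] | (ysize t <= N)%N].

Lemma trees_uniq (N : nat) : uniq (trees N).
Proof. exact/filter_uniq/undup_uniq. Qed.

Lemma mem_trees (N : nat) (t : ytree) : (t \in trees N) = (ysize t <= N)%N.
Proof.
rewrite mem_filter mem_undup; case: leqP => //= tN.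
apply/mapP; exists (repr t); rewrite ?ypiK//.
exact/mem_ptrees/(leq_trans _ tN)/ltnW/pheight_lt_size.
Qed.

Lemma ysize_gt0 (t : ytree) : (0 < ysize t)%N.
Proof. exact: psize_gt0. Qed.

Lemma ytree_yle_cases (t : ytree) :
  t = yleaf \/ exists2 u : ytree * ytree, yle u.1 u.2 & t = ynode u.1 u.2.
Proof.
have [->|[a [b ->]]] := ytree_cases t; [by left|right].
have /orP[ab|ba] := yle_total a b; first by exists (a, b).
by exists (b, a); rewrite // ynodeC.
Qed.

Definition ygf (R : pzRingType) (N : nat) (z : R) : R :=
  \sum_(t <- trees N) z ^+ ysize t.

Lemma ygf_sqr (R : comNzRingType) (N : nat) (z : R) :
  (\sum_(u <- [seq (a, b) | a <- trees N, b <- trees N] | yle u.1 u.2)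
     z ^+ (ysize u.1 + ysize u.2)) *+ 2 = ygf N z ^+ 2 + ygf N (z ^+ 2).
Proof.
rewrite (@sum_yle R (trees N) (fun a b => z ^+ (ysize a + ysize b))) //; last first.
- by move=> a b; rewrite addnC.
- exact: trees_uniq.
congr (_ + _); last by apply: eq_bigr => t _; rewrite -exprM mul2n addnn.
rewrite expr2 big_distrlr; apply: eq_bigr => a _; apply: eq_bigr => b _.
by rewrite exprD.
Qed.

Lemma ygf_ge0 (R : numDomainType) (N : nat) (z : R) : 0 <= z -> 0 <= ygf N z.
Proof. by move=> z0; apply: sumr_ge0 => t _; apply: exprn_ge0. Qed.

Lemma ygf_subset (R : numDomainType) (N M : nat) (z : R) :
  0 <= z -> (N <= M)%N -> ygf N z <= ygf M z.
Proof.
move=> z0 NM; apply: ler_sum_sub; [by move=> t; apply: exprn_ge0|exact: trees_uniq|].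
by move=> t; rewrite !mem_trees => /leq_trans; apply.
Qed.

Lemma ygf_mono (R : numDomainType) (N : nat) (z w : R) :
  0 <= z -> z <= w -> ygf N z <= ygf N w.
Proof.
move=> z0 zw; apply: ler_sum => t _.
by apply: lerXn2r; rewrite ?nnegrE ?(le_trans z0).
Qed.

Lemma ygf0 (R : pzRingType) (z : R) : ygf 0 z = 0.
Proof.
rewrite /ygf big_seq big1 // => t; rewrite mem_trees leqn0.
by have := ysize_gt0 t; case: ysize.
Qed.

Lemma ygf_at0 (R : pzRingType) (N : nat) : ygf N (0 : R) = 0.
Proof.
by rewrite /ygf big1 // => t _; rewrite expr0n; case: ysize (ysize_gt0 t).
Qed.

Lemma sum_ynode (R : pzRingType) (s : seq (ytree * ytree)) (z : R) :
  \sum_(t <- yleaf :: [seq ynode u.1 u.2 | u <- s]) z ^+ ysize t =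
  z + \sum_(u <- s) z ^+ (ysize u.1 + ysize u.2).
Proof.
rewrite big_cons ysize_leaf expr1 big_map; congr (_ + _).
by apply: eq_bigr => u _; rewrite ysize_node.
Qed.

(** The sibling of a subtree has size at least 1, so a tree of size at most [N.+1] splits into
    subtrees of size at most [N]. *)
Lemma ygf_upper (R : numDomainType) (N : nat) (z : R) : 0 <= z ->
  ygf N.+1 z *+ 2 <= z *+ 2 + (ygf N z ^+ 2 + ygf N (z ^+ 2)).
Proof.
move=> z0; rewrite -ygf_sqr -mulrnDl ler_pMn2r // -big_filter -sum_ynode.
apply: ler_sum_sub; [by move=> t; apply: exprn_ge0|exact: trees_uniq|move=> t].
rewrite mem_trees inE => tN; have [->|[u u12 tu]] := ytree_yle_cases t.
  by rewrite eqxx.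
apply/orP; right; rewrite tu; apply: map_f; rewrite mem_filter u12.
rewrite [u]surjective_pairing; apply: (@allpairs_f _ _ _ pair); rewrite mem_trees.
all: move: tN; rewrite tu ysize_node.
  by have := ysize_gt0 u.2; lia.
by have := ysize_gt0 u.1; lia.
Qed.

(** Conversely, ordered representatives of pairs from [trees N] give distinct nodes of size at most
    [N.*2]; [0 < N] makes room for the leaf. *)
Lemma ygf_lower (R : numDomainType) (N : nat) (z : R) : 0 <= z -> (0 < N)%N ->
  z *+ 2 + (ygf N z ^+ 2 + ygf N (z ^+ 2)) <= ygf N.*2 z *+ 2.
Proof.
move=> z0 N0; rewrite -ygf_sqr -mulrnDl ler_pMn2r // -big_filter -sum_ynode.
apply: ler_sum_sub; first by move=> t; apply: exprn_ge0.
- rewrite cons_uniq; apply/andP; split.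
    by apply/mapP => -[u _]; apply: yleaf_neq_ynode.
  rewrite map_inj_in_uniq.
    by apply/filter_uniq/allpairs_uniq; rewrite ?trees_uniq // => -[a b] [].
  move=> u v; rewrite !mem_filter => /andP[u12 _] /andP[v12 _].
  exact: ynode_yle_inj.
- move=> t; rewrite mem_trees inE => /orP[/eqP->|].
    by rewrite ysize_leaf; lia.
  case/mapP=> u; rewrite mem_filter => /andP[_ /allpairsP[[a b] /= [aN bN ->]]] ->.
  by move: aN bN; rewrite ysize_node !mem_trees /=; lia.
Qed.

(** By induction on [h]: one child of the root has height at least [h], and the other, arbitrary,
    costs one factor [ygf N z]. *)
Lemma ygf_height (R : numDomainType) (N h : nat) (z : R) : 0 <= z ->
  \sum_(t <- trees N | (h <= yheight t)%N) z ^+ ysize t <= ygf N z ^+ h.+1.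
Proof.
move=> z0; elim: h => [|h IH]; first by rewrite expr1.
rewrite exprSr; apply: (le_trans _ (ler_wpM2r (ygf_ge0 N z0) IH)).
rewrite big_distrlr /= -big_filter -[X in _ <= X]big_filter.
set r := [seq t <- trees N | (h <= yheight t)%N].
rewrite (_ : \sum_(i <- r) _ =
   \sum_(t <- [seq ynode u.1 u.2 | u <- [seq (a, b) | a <- r, b <- trees N]])
      z ^+ ysize t); last first.
  rewrite big_map big_allpairs; apply: eq_bigr => a _; apply: eq_bigr => b _.
  by rewrite ysize_node exprD.
apply: ler_sum_sub; first by move=> t; apply: exprn_ge0.
  exact/filter_uniq/trees_uniq.
move=> t; rewrite mem_filter mem_trees => /andP[ht tN].
have [a [b [tab ha aN bN]]] : exists a b, [/\ t = ynode a b, (h <= yheight a)%N,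
    (ysize a <= N)%N & (ysize b <= N)%N].
  have [tl|[a [b tab]]] := ytree_cases t; first by rewrite tl yheight_leaf in ht.
  move: tN ht; rewrite tab ysize_node yheight_node ltnS leq_max => abN.
  case/orP => hh; [exists a, b|exists b, a]; split => //; try by lia.
  exact: ynodeC.
rewrite tab; apply/mapP; exists (a, b) => //.
apply: (@allpairs_f _ _ _ pair r (trees N)); last by rewrite mem_trees.
by rewrite mem_filter ha mem_trees.
Qed.

(** * Numbers of trees of given size *)

Definition ycount (n : nat) : nat := #|` fset_set (Y_ n)|.

Lemma mem_Y (n : nat) (t : ytree) : (t \in fset_set (Y_ n)) = (ysize t == n).
Proof.
rewrite in_fset_set; last exact: finite_Y.
by apply/idP/eqP; rewrite inE.
Qed.

Lemma ycount_gt0 (n : nat) : (0 < n)%N -> (0 < ycount n)%N.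
Proof.
move=> /Y_neq0[t tn]; rewrite /ycount cardfs_gt0; apply/fset0Pn; exists t.
by rewrite mem_Y; apply/eqP.
Qed.

(** [ynode] is injective on the pairs ordered by [yle] and on those that are not; each half injects
    into [Y_ (n + m)]. *)
Lemma ycountD (n m : nat) : (ycount n * ycount m <= 2 * ycount (n + m))%N.
Proof.
set s := [seq (a, b) | a <- fset_set (Y_ n), b <- fset_set (Y_ m)].
have us : uniq s by apply: allpairs_uniq; rewrite ?fset_uniq // => -[a b] [].
have snm u : u \in s -> ysize (ynode u.1 u.2) = (n + m)%N.
  case/allpairsP=> -[a b] /= [+ + ->].
  by rewrite !mem_Y ysize_node => /eqP-> /eqP->.
rewrite -(size_allpairs pair) -/s -(count_predC (fun u => yle u.1 u.2)) mul2n -addnn.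
apply: leq_add; rewrite -size_filter -(size_map (fun u => ynode u.1 u.2)).
  apply: uniq_leq_size => [|t /mapP[u]].
    rewrite map_inj_in_uniq ?filter_uniq // => u v.
    by rewrite !mem_filter => /andP[u12 _] /andP[v12 _]; apply: ynode_yle_inj.
  by rewrite mem_filter mem_Y => /andP[_ /snm <-] ->.
apply: uniq_leq_size => [|t /mapP[u]].
  rewrite map_inj_in_uniq ?filter_uniq // => -[a b] [c d].
  rewrite !mem_filter /= => /andP[ab _] /andP[cd _].
  rewrite ynodeC (ynodeC c) => abcd.
  have ba : yle b a by have := yle_total a b; rewrite (negPf ab).
  have dc : yle d c by have := yle_total c d; rewrite (negPf cd).
  by have [-> ->] := @ynode_yle_inj (b, a) (d, c) ba dc abcd.
by rewrite mem_filter mem_Y => /andP[_ /snm <-] ->.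
Qed.

Lemma ycount_event (R : pzRingType) (n : nat) (E : set ytree) (z : R) :
  #|` fset_set (Y_ n `&` E)|%:R * z ^+ n =
  \sum_(t <- fset_set (Y_ n `&` E)) z ^+ ysize t.
Proof.
rewrite (eq_big_seq (fun=> z ^+ n)); last first.
  move=> t; rewrite in_fset_set ?inE; last by apply: finite_setIl; apply: finite_Y.
  by case=> ->.
by rewrite big_const_seq count_predT iter_addr_0 mulr_natl.
Qed.

Lemma ycountE (R : pzRingType) (n : nat) (z : R) :
  (ycount n)%:R * z ^+ n = \sum_(t <- fset_set (Y_ n)) z ^+ ysize t.
Proof. by have := ycount_event n setT z; rewrite setIT. Qed.

Lemma ycount_le_ygf (R : numDomainType) (n : nat) (z : R) : 0 <= z ->
  (ycount n)%:R * z ^+ n <= ygf n z.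
Proof.
move=> z0; rewrite ycountE; apply: ler_sum_sub; first by move=> t; apply: exprn_ge0.
  exact: fset_uniq.
by move=> t; rewrite mem_Y mem_trees => /eqP->.
Qed.

Lemma ygf_step (R : numDomainType) (N : nat) (z : R) : 0 <= z ->
  ygf N.+1 z <= ygf N z + (ycount N.+1)%:R * z ^+ N.+1.
Proof.
move=> z0; rewrite ycountE -big_cat; apply: ler_sum_sub.
  by move=> t; apply: exprn_ge0.
  exact: trees_uniq.
by move=> t; rewrite mem_cat mem_Y !mem_trees; lia.
Qed.

(** * The radius of convergence *)

(** The bound 1/2 is stable under the recursion at 1/8: 1/8 + (1/4 + 1/2)/2 = 1/2. *)
Lemma ygf_eighth (R : realFieldType) (N : nat) : ygf N (8^-1 : R) <= 2^-1.
Proof.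
elim: N => [|N IH]; first by rewrite ygf0; lra.
have z0 : 0 <= 8^-1 :> R by lra.
have := ygf_upper N z0; have := ygf_ge0 N z0.
have : ygf N ((8^-1 : R) ^+ 2) <= ygf N 8^-1 by apply: ygf_mono; lra.
by nra.
Qed.

(* Equivalent to z <= rho: by supermultiplicativity of a_n / 2, the constant 2
   bounds a_n z^n as soon as the power series converges below z. *)
Definition ygood (R : realType) : set R :=
  [set z | 0 <= z /\ forall n, (ycount n)%:R * z ^+ n <= 2].

Definition yradius (R : realType) : R := sup (@ygood R).

Lemma ygood_eighth (R : realType) : @ygood R 8^-1.
Proof.
split=> [|n]; first by lra.
apply: (le_trans (ycount_le_ygf n _)); first by lra.
by apply: (le_trans (ygf_eighth R n)); lra.
Qed.

Lemma has_sup_ygood (R : realType) : has_sup (@ygood R).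
Proof.
split; first by exists 8^-1; apply: ygood_eighth.
exists 2 => z [z0 /(_ 1%N)]; rewrite expr1; apply: le_trans.
by rewrite ler_peMl // ler1n ycount_gt0.
Qed.

Lemma yradius_gt0 (R : realType) : 0 < yradius R.
Proof.
apply: (@lt_le_trans _ _ 8^-1); first by lra.
exact/(sup_upper_bound (has_sup_ygood R))/ygood_eighth.
Qed.

Lemma lt_yradius (R : realType) (z : R) : z < yradius R ->
  exists2 w, z < w & ygood w.
Proof.
move=> zr; have e0 : 0 < yradius R - z by rewrite subr_gt0.
have [w gw] := sup_adherent e0 (has_sup_ygood R).
by rewrite -/(yradius R) => zw; exists w => //; lra.
Qed.

Lemma ygf_bounded (R : realType) (z : R) : 0 <= z -> z < yradius R ->
  exists C, forall N, ygf N z <= C.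
Proof.
move=> z0 /lt_yradius[w zw [w0 gw]].
have w_gt0 : 0 < w by apply: le_lt_trans zw.
pose q := z / w; have q0 : 0 <= q by rewrite divr_ge0.
have q1 : q < 1 by rewrite ltr_pdivrMr ?mul1r.
have zE : z = w * q by rewrite /q mulrC divfK ?gt_eqF.
(* Comparison with a geometric series: goodness of [w] gives a_n z^n <= 2 q^n. *)
have geo N : ygf N z * (1 - q) <= 2 * (1 - q ^+ N.+1).
  elim: N => [|N IH]; first by rewrite ygf0 expr1; lra.
  have aN : (ycount N.+1)%:R * z ^+ N.+1 <= 2 * q ^+ N.+1.
    by rewrite zE exprMn mulrA; apply: ler_wpM2r; rewrite ?exprn_ge0.
  have := ygf_step N z0; rewrite (exprS q N.+1).
  move: (ygf N.+1 z) (ygf N z) (_ * _ ^+ _) (q ^+ N.+1) IH aN => y' y a p; nra.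
exists (2 / (1 - q)) => N; rewrite ler_pdivlMr ?subr_gt0 //.
apply: (le_trans (geo N)); have := exprn_ge0 N.+1 q0; lra.
Qed.

(** * The square-root bound below the radius *)

(** In the limit, y(z^2) = 1 - 2 z - (1 - y(z))^2. For finite [P], [ygf P z] is chosen within
    [e / 2] of the supremum, so replacing [ygf P.*2 z] by it in [ygf_lower] costs at most [e]. *)
Lemma ygf_sqr_le (R : realType) (M : nat) (z : R) : 0 <= z -> z < yradius R ->
  ygf M (z ^+ 2) <= 1 - z *+ 2.
Proof.
move=> z0 zr; have [C yC] := ygf_bounded z0 zr.
pose V := range (fun N => ygf N z).
have hV : has_sup V by split; [exists (ygf 0 z), 0%N|exists C => _ [N _ <-]].
have ub N : ygf N z <= sup V by apply: sup_upper_bound => //; exists N.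
apply/ler_addgt0Pr => e e0.
have e20 : 0 < e / 2 by lra.
have [_ [N _ <-] yN] := sup_adherent e20 hV.
pose P := maxn M N.+1.
have P0 : (0 < P)%N by rewrite /P; lia.
have NP : ygf N z <= ygf P z by apply: ygf_subset => //; rewrite /P; lia.
have MP : ygf M (z ^+ 2) <= ygf P (z ^+ 2).
  by apply: ygf_subset; [apply: exprn_ge0|rewrite /P; lia].
have := ygf_lower z0 P0; have := ub P.*2.
have := sqr_ge0 (1 - ygf P z).
lra.
Qed.

Lemma yradius_le1 (R : realType) : yradius R <= 1.
Proof.
rewrite leNgt; apply/negP => r1; have r0 : 0 <= 1 :> R by [].
by have := ygf_sqr_le 0 r0 r1; rewrite ygf0; lra.
Qed.

Lemma ygf_gap (R : realType) (N : nat) (z : R) : 0 <= z -> z < yradius R ->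
  yradius R - z <= (1 - ygf N z) ^+ 2.
Proof.
(* At the midpoint, y_N(z^2) <= y_N(w^2) <= 1 - 2 w = 1 - z - rho, which leaves exactly rho - z. *)
move=> z0 zr; pose w := (z + yradius R) / 2.
have zw : z <= w by rewrite /w; lra.
have wr : w < yradius R by rewrite /w; lra.
have := ygf_sqr_le N (le_trans z0 zw) wr.
have := ygf_upper N z0; have := ygf_subset z0 (leqnSn N).
have : ygf N (z ^+ 2) <= ygf N (w ^+ 2).
  apply: ygf_mono; first exact: exprn_ge0.
  by rewrite lerXn2r // nnegrE; lra.
have -> : w *+ 2 = z + yradius R by rewrite /w; lra.
by nra.
Qed.

(** Fixes the sign of the root in [ygf_gap]: the polynomial vanishes at 0, so to reach 1 it would
    have to equal 1 somewhere in [0, z], where the gap is positive. *)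
Lemma ygf_lt1 (R : realType) (N : nat) (z : R) : 0 <= z -> z < yradius R ->
  ygf N z < 1.
Proof.
move=> z0 zr; rewrite ltNge; apply/negP => y1.
pose p : {poly R} := \sum_(t <- trees N) 'X^(ysize t) - 1.
have pE x : p.[x] = ygf N x - 1.
  rewrite hornerD hornerN hornerC horner_sum; congr (_ - _).
  by apply: eq_bigr => t _; rewrite hornerXn.
have [|x /andP[x0 xz]] := @poly_ivt R p 0 z z0.
  by rewrite !pE ygf_at0; lra.
rewrite /root pE subr_eq0 => /eqP yx.
have := ygf_gap N x0 (le_lt_trans xz zr); rewrite yx subrr expr0n /=.
by lra.
Qed.

Lemma ygf_le (R : realType) (N : nat) (s : R) : 0 < s -> s ^+ 2 <= yradius R ->
  ygf N (yradius R - s ^+ 2) <= 1 - s.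
Proof.
move=> s0 sr; set z := _ - _.
have z0 : 0 <= z by rewrite subr_ge0.
have zr : z < yradius R by rewrite /z; have := exprn_gt0 2 s0; lra.
have := ygf_lt1 N z0 zr; have := ygf_gap N z0 zr.
rewrite (_ : yradius R - z = s ^+ 2); last by rewrite /z; lra.
move=> + y1; rewrite ler_sqr ?nnegrE; lra.
Qed.

(** * Growth of the counts and the tail of the height *)

Lemma ycount_growth (R : realType) (e : R) : 0 < e ->
  exists2 c : R, 0 < c & forall n, (0 < n)%N ->
    c * expR (- (n%:R * e)) <= (ycount n)%:R * yradius R ^+ n.
Proof.
move=> e0; have r0 := yradius_gt0 R; have r1 := yradius_le1 R.
(* [yradius R * expR e] exceeds the supremum, so it is not good. *)
have [m mP] : exists m, 2 < (ycount m)%:R * (yradius R * expR e) ^+ m.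
  apply: contrapT => /forallNP h.
  have : ygood (yradius R * expR e).
    split; first by rewrite mulr_ge0 ?expR_ge0 // ltW.
    by move=> n; rewrite leNgt; apply/negP/h.
  move/(sup_upper_bound (has_sup_ygood R)); rewrite -/(yradius R).
  by rewrite -ler_pdivlMl // mulVf ?gt_eqF // leNgt -expR0 ltr_expR e0.
have m0 : (0 < m)%N.
  case: m mP => // /lt_le_trans/(_ (ycount_le_ygf 0 _)); rewrite ygf0.
  by rewrite mulr_ge0 ?expR_ge0 ?(ltW r0) // => /(_ isT); rewrite ltrn0.
(* This constant covers n <= m, where a_n >= 1 and rho <= 1; larger n descend by steps of [m]. *)
exists (yradius R ^+ m); first exact: exprn_gt0.
elim/ltn_ind => n IH n0; have [nm|mn] := leqP n m.
  apply: (@le_trans _ _ (yradius R ^+ m)).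
    rewrite ger_pMr ?exprn_gt0 // -expR0 ler_expR oppr_le0 mulr_ge0 // ltW//.
  apply: (@le_trans _ _ (yradius R ^+ n)).
    by apply: ler_wiXn2l => //; apply: ltW.
  by rewrite ler_peMl ?exprn_ge0 ?(ltW r0) // ler1n ycount_gt0.
have {IH} := IH (n - m)%N; rewrite subn_gt0 mn => /(_ _ isT) IH.
have {}IH := IH ltac:(lia).
have := ycountD (n - m) m; rewrite subnK ?(ltnW mn) // -(ler_nat R) !natrM => amn.
(* The 2 gained here pays for the 2 lost in [ycountD]. *)
have am : expR (- (m%:R * e)) * 2 <= (ycount m)%:R * yradius R ^+ m.
  rewrite mulrC expRN ler_pdivrMr ?expR_gt0 // expRM_natl -mulrA -exprMn.
  exact: ltW.
have -> : expR (- (n%:R * e)) = expR (- ((n - m)%:R * e)) * expR (- (m%:R * e)).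
  by rewrite -expRD natrB ?(ltnW mn) //; congr expR; ring.
have -> : yradius R ^+ n = yradius R ^+ (n - m) * yradius R ^+ m.
  by rewrite -exprD subnK // ltnW.
rewrite -(ler_pM2l (ltr0n R 2)).
have p0 : 0 <= yradius R ^+ (n - m) * yradius R ^+ m.
  by rewrite mulr_ge0 ?exprn_ge0 // ltW.
apply: le_trans (le_trans (ler_pM _ _ IH am) _); rewrite ?mulr_ge0 ?expR_ge0 ?exprn_ge0 ?(ltW r0) //.
  by rewrite le_eqVlt; apply/orP; left; apply/eqP; ring.
have := ler_wpM2r p0 amn.
by congr (_ <= _); ring.
Qed.

(* The exponent -n x s + 2 n s^2 / rho is minimal at s = rho x / 4. *)
Lemma ycount_height (R : realType) (n : nat) (x : R) : 0 < x -> x <= 1 ->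
  #|` fset_set (Y_ n `&` [set t | x * n%:R <= (yheight t)%:R])|%:R * yradius R ^+ n
    <= expR (- (n%:R * (yradius R * x ^+ 2 / 8))).
Proof.
move=> x0 x1; set A := #|` _|; pose r := yradius R.
have r0 : 0 < r := yradius_gt0 R; have r1 : r <= 1 := yradius_le1 R.
pose s := r * x / 4; pose u := r * x ^+ 2 / 16.
have s0 : 0 < s by rewrite /s divr_gt0 ?mulr_gt0.
have srE : s ^+ 2 = r * u by rewrite /s /u; field.
have u0 : 0 <= u by rewrite /u divr_ge0 ?mulr_ge0 ?sqr_ge0 ?ltW.
have u1 : u <= 2^-1 by rewrite /u; nra.
have sr : s ^+ 2 <= r by rewrite srE; nra.
pose z := r - s ^+ 2.
have z0 : 0 <= z by rewrite subr_ge0.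
(* Price of replacing rho by z = rho (1 - u): (1 - u)(1 + 2 u) >= 1 for u <= 1/2. *)
have rz : r <= z * expR (2 * u).
  have := expR_ge1Dx (2 * u); rewrite /z srE; move: (expR _) => E hE.
  have : 1 <= (1 - u) * (1 + 2 * u) by nra.
  have : (1 - u) * (1 + 2 * u) <= (1 - u) * E by apply: ler_wpM2l => //; lra.
  by nra.
have Az : A%:R * z ^+ n <= expR (- (n%:R * (x * s))).
  (* Rounding down is harmless: the exponent [h.+1] of [ygf_height] still exceeds x n. *)
  pose h := Num.truncn (x * n%:R).
  have xn0 : 0 <= x * n%:R by rewrite mulr_ge0 // ltW.
  have /andP[hx xh] := truncn_itv xn0; rewrite -/h in hx xh.
  apply: (@le_trans _ _ (ygf n z ^+ h.+1)).
    rewrite ycount_event; apply: le_trans (ygf_height n h z0).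
    rewrite -[leRHS]big_filter; apply: ler_sum_sub.
    - by move=> t; apply: exprn_ge0.
    - exact: fset_uniq.
    move=> t; rewrite in_fset_set ?inE; last by apply: finite_setIl; apply: finite_Y.
    case=> tn xt; rewrite mem_filter mem_trees tn leqnn andbT -(ler_nat R).
    exact: le_trans hx xt.
  apply: (@le_trans _ _ (expR (- s) ^+ h.+1)).
    rewrite lerXn2r ?nnegrE ?ygf_ge0 ?expR_ge0 //.
    exact: le_trans (ygf_le n s0 sr) (expR_ge1Dx (- s)).
  by rewrite -expRM_natl ler_expR; nra.
have E0 := expR_ge0 (n%:R * (2 * u)).
apply: (@le_trans _ _ (A%:R * z ^+ n * expR (n%:R * (2 * u)))).
  rewrite expRM_natl -mulrA -exprMn ler_wpM2l // lerXn2r // nnegrE.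
    exact: ltW.
  by rewrite mulr_ge0 // expR_ge0.
apply: le_trans (ler_wpM2r E0 Az) _.
rewrite -expRD ler_expR le_eqVlt; apply/orP; left; apply/eqP.
by rewrite /s /u -/r; field.
Qed.

Theorem theorem5 (R : realType) :
  exists I : R -> R,
    [/\ {within [set` `]0, 1]], continuous I},
        {in `]0, 1] &, forall u v : R, u < v -> I u < I v},
        (forall u : R, 0 < u <= 1 -> 0 < I u) &
        forall delta : R, 0 < delta ->
          exists K : R,
            forall (x : R) (n : nat),
              delta <= x <= 1 - delta -> (1 <= n)%N ->
              finite_unif_prob R (Y_ n) [set t | x * n%:R <= (yheight t)%:R]
                <= K * n%:R `^ (3 / 2) * expR (- (n%:R * I x))].
Proof.
have r0 := yradius_gt0 R.
exists (fun u => yradius R / 16 * u ^+ 2); split.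
- by apply: continuous_subspaceT => x; apply: cvgMr; apply: exprn_continuous.
- move=> u v; rewrite !in_itv /= => /andP[u0 _] /andP[v0 _] uv.
  by rewrite ltr_pM2l ?divr_gt0 // ltr_pXn2r // nnegrE ltW.
- by move=> u /andP[u0 _]; rewrite mulr_gt0 ?divr_gt0 ?exprn_gt0.
(* [e] is I(delta), hence at most I(x), so I(x) + e <= 2 I(x) = rho x^2 / 8, the exponent of
   [ycount_height]. *)
move=> d d0; pose e := yradius R / 16 * d ^+ 2.
have e0 : 0 < e by rewrite mulr_gt0 ?divr_gt0 ?exprn_gt0.
have [c c0 cP] := ycount_growth e0.
exists c^-1 => x n /andP[dx xd] n0.
have x0 : 0 < x by apply: lt_le_trans dx.
have x1 : x <= 1 by lra.
have p1 : 1 <= n%:R `^ (3 / 2) :> R.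
  by rewrite -[leLHS](powRr0 n%:R); apply: ler_powR; rewrite ?ler1n //; lra.
rewrite /finite_unif_prob -/(ycount n).
set A := #|` _|.
have := ycount_height n x0 x1; rewrite -/A => hA.
have a0 : 0 < (ycount n)%:R :> R by rewrite ltr0n ycount_gt0.
have rn0 : 0 < yradius R ^+ n by rewrite exprn_gt0.
have E0 := expR_gt0 (- (n%:R * (yradius R / 16 * x ^+ 2))).
rewrite ler_pdivrMr // -(ler_pM2r rn0); apply: (le_trans hA).
apply: (@le_trans _ _ (c^-1 * expR (- (n%:R * (yradius R / 16 * x ^+ 2))) *
    (c * expR (- (n%:R * e))))).
  rewrite mulrACA mulVf ?gt_eqF // mul1r -expRD ler_expR.
  have : d ^+ 2 <= x ^+ 2 by rewrite lerXn2r // nnegrE ltW.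
  have n0' : 0 <= n%:R :> R by [].
  rewrite /e => dx2; rewrite -subr_ge0.
  rewrite (_ : _ - _ = n%:R * (yradius R / 16 * (x ^+ 2 - d ^+ 2))); last by field.
  by rewrite !mulr_ge0 ?subr_ge0 ?invr_ge0 // ltW.
rewrite -[leRHS]mulrA; apply: ler_pM; rewrite ?mulr_ge0 ?expR_ge0 ?invr_ge0 ?(ltW c0) ?cP //.
by rewrite ler_pM2r // ler_peMr // invr_ge0 ltW.
Qed.
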